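(* Let $S_1,S_2\subset\mathbb{R}^3$ be two real rational ruled surfaces properly parametrized by $\boldsymbol{x}_i(t,s)=\boldsymbol{p}_i(t)+s\,\boldsymbol{q}_i(t)$, $i=1,2$, which are neither doubly ruled nor cylindrical. Let $\boldsymbol{q}_i(t)=(q_{i,1}(t),q_{i,2}(t),q_{i,3}(t))$ with $q_{i,j}(t)\in\mathbb{R}[t]$ and $\gcd(q_{i,1},q_{i,2},q_{i,3})=1$ for $i=1,2$, and suppose $n_1=n_2=n$, where $n_i=\max\{\deg q_{i,1},\deg q_{i,2},\deg q_{i,3}\}$. Let $f(\mathbf{x})=\boldsymbol{A}\mathbf{x}+\boldsymbol{b}$, with $\boldsymbol{A}\in\mathbb{R}^{3\times3}$ nonsingular and $\boldsymbol{b}\in\mathbb{R}^3$, be such that $f(S_1)=S_2$, and let $\varphi:\mathbb{R}^2\dashrightarrow\mathbb{R}^2$ be the birational transformation satisfying $f\circ\boldsymbol{x}_1=\boldsymbol{x}_2\circ\varphi$. Then $$\varphi(t,s)=\bigl(\psi(t),\;k\,(\gamma t+\delta)^{n}\,s+c(t)\bigr),$$ where $\psi(t)=\dfrac{\alpha t+\beta}{\gamma t+\delta}$ with $\alpha\delta-\beta\gamma\neq0$ is a Möbius transformation, $k$ is a constant, and $c(t)$ is a rational function, satisfying $$\boldsymbol{A}\,\boldsymbol{q}_1(t)=k\,(\gamma t+\delta)^{n}\,\boldsymbol{q}_2(\psi(t)).$$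
   Context: Here $\boldsymbol{p}_i$ is a triple of real rational functions of $t$, and $S_i$ is the (irreducible, two-dimensional) real algebraic surface parametrized by $\boldsymbol{x}_i$, i.e. the Zariski closure in $\mathbb{R}^3$ of the image of $\boldsymbol{x}_i$. The parametrization is proper if it is birational as a map $\mathbb{R}^2\dashrightarrow S_i$. The rulings of $S_i$ are the lines $s\mapsto\boldsymbol{x}_i(t,s)$; $S_i$ is doubly ruled if it contains two different families of rulings (this happens exactly for the plane, the hyperbolic paraboloid and the single-sheeted hyperboloid). $S_i$ is cylindrical if all its rulings are parallel (equivalently, under the coprimality assumption, $\boldsymbol{q}_i$ is constant). The equality $f\circ\boldsymbol{x}_1=\boldsymbol{x}_2\circ\varphi$ is an equality of rational maps, i.e. it holds at generic $(t,s)$; given $f$, the birational map $\varphi=\boldsymbol{x}_2^{-1}\circ f\circ\boldsymbol{x}_1$ is the unique one satisfying it. All coefficients and constants are real. *)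

(* Defs.v *)
From HB Require Import structures.
From mathcomp Require Export all_boot all_order all_algebra.
From mathcomp Require Export boolp classical_sets cardinality reals.
From mathcomp Require Export mpoly.

Set Implicit Arguments.
Unset Strict Implicit.
Unset Printing Implicit Defensive.

Import GRing.Theory.

Local Open Scope classical_set_scope.
Local Open Scope ring_scope.

Section RationalMaps.
Variable R : realType.

(* The value of a polynomial at the point of R^m with coordinate column a. *)
Definition peval (m : nat) (a : 'cV[R]_m) (P : {mpoly R[m]}) : R :=
  P.@[fun i => a i 0].

(* [frac_at ev f y]: the fraction f is regular at the point at which [ev]
   evaluates polynomials, and y is its value there. The representative N / D is
   quantified because [\n_(repr f) / \d_(repr f)] need not be in lowest terms,
   so it may fail to be defined at points where f is regular. *)
Definition frac_at (A : idomainType) (ev : A -> R) (f : {fraction A}) (y : R) :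
    Prop :=
  exists N D : A,
    [/\ f = tofrac N / tofrac D, ev D != 0 & y = ev N / ev D].

Definition ratfun_at (f : {fraction {poly R}}) (t y : R) : Prop :=
  frac_at (fun P : {poly R} => P.[t]) f y.

Definition ratcurve_at (p : 'cV[{fraction {poly R}}]_3) (t : R) (u : 'cV[R]_3) :
    Prop :=
  forall j, ratfun_at (p j 0) t (u j 0).

(* Rational maps from R^m to R^n are given by their components. *)
Definition ratmap (m n : nat) : Type := 'cV[{fraction {mpoly R[m]}}]_n.

Definition ratmap_at (m n : nat) (g : ratmap m n) (a : 'cV[R]_m)
    (b : 'cV[R]_n) : Prop :=
  forall j, frac_at (peval a) (g j 0) (b j 0).

Definition zariski_closure (m : nat) (X : set 'cV[R]_m) : set 'cV[R]_m :=
  [set a | forall P : {mpoly R[m]},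
     (forall x, X x -> peval x P = 0) -> peval a P = 0].

(* P holds at the generic point of the irreducible algebraic set X: on the
   complement in X of the zero set of a polynomial not vanishing on all of X. *)
Definition generically (m : nat) (X : set 'cV[R]_m) (P : 'cV[R]_m -> Prop) :
    Prop :=
  exists h : {mpoly R[m]},
    (exists2 x, X x & peval x h != 0) /\
    (forall x, X x -> peval x h != 0 -> P x).

(* A rational map from X to Y, given by the relation "F is defined at a with
   value b", is birational if it has a rational inverse from Y to X. *)
Definition birational (m n : nat) (X : set 'cV[R]_m) (Y : set 'cV[R]_n)
    (F : 'cV[R]_m -> 'cV[R]_n -> Prop) : Prop :=
  exists g : ratmap n m,
    generically X (fun a => exists b, [/\ Y b, F a b & ratmap_at g b a]) /\
    generically Y (fun b => exists a, [/\ X a, ratmap_at g b a & F a b]).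

End RationalMaps.

Section RuledSurfaces.
Variable R : realType.
Implicit Types (p : 'cV[{fraction {poly R}}]_3) (q : 'cV[{poly R}]_3).

Definition dir_at q (t : R) : 'cV[R]_3 := \col_j (q j 0).[t].

(* x(t, s) = p(t) + s q(t), where a = (t, s). *)
Definition ruled_at p q (a : 'cV[R]_2) (b : 'cV[R]_3) : Prop :=
  exists2 u, ratcurve_at p (a 0 0) u & b = u + a 1 0 *: dir_at q (a 0 0).

Definition ruled_surface p q : set 'cV[R]_3 :=
  zariski_closure [set b | exists a, ruled_at p q a b].

Definition proper_param p q : Prop :=
  birational [set: 'cV[R]_2] (ruled_surface p q) (ruled_at p q).

Definition coprime_dir q : Prop :=
  gcdp (gcdp (q 0 0) (q 1 0)) (q 2 0) %= 1.

Definition dir_degree q : nat := \max_(j < 3) (size (q j 0%R)).-1.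

Definition rulings p q : set (set 'cV[R]_3) :=
  [set L | exists t u,
     ratcurve_at p t u /\ L = range (fun s : R => u + s *: dir_at q t)].

Definition cylindrical p q : Prop :=
  forall L M, rulings p q L -> rulings p q M ->
    exists w : 'cV[R]_3, M = [set x + w | x in L].

(* A rational parametrization of a family of lines can miss finitely many lines
   of the family (the one at t = oo, and those at the poles of p), so families
   are compared up to finite sets of lines. Properness excludes
   reparametrizations such as t |-> t ^+ 2, which would miss infinitely many. *)
Definition same_family (F G : set (set 'cV[R]_3)) : Prop :=
  finite_set (F `\` G) /\ finite_set (G `\` F).

Definition ruling_family (S : set 'cV[R]_3) (F : set (set 'cV[R]_3)) : Prop :=
  exists p q, [/\ coprime_dir q, proper_param p q, ruled_surface p q = S &
    F = rulings p q].

Definition doubly_ruled (S : set 'cV[R]_3) : Prop :=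
  exists F G, [/\ ruling_family S F, ruling_family S G & ~ same_family F G].

End RuledSurfaces.

(* Main.v *)
(* An affine map f with f(S1) = S2 carries the rulings of S1 to a ruling family of S2, and
   since S2 is not doubly ruled this is, up to finitely many lines, the given one. So for almost
   every t the line f(x1(t, -)) is the ruling of S2 at some parameter tau. Generic injectivity of
   x2 and dominance of phi then give phi(t, s) = (tau, l s + m) with l, m independent of s; as
   this is a polynomial identity in s, freezing s at a constant s0 exhibits tau = N(t) / D(t) and
   m as rational functions of t, with N and D coprime.
   Finally A q1(t) is proportional to q2(N / D). The homogenization D^n q2(N / D) is again a
   triple of polynomials without common factor, of degree exactly n max(deg N, deg D), so it is a
   constant multiple of A q1; comparing degrees gives max(deg N, deg D) = 1. *)
From HB Require Import structures.
Require Import Defs.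
From mathcomp Require Import generic_quotient ring.
Import Order.TTheory GRing.Theory Num.Theory.
Local Open Scope classical_set_scope.
Local Open Scope ring_scope.
Set Implicit Arguments.
Unset Strict Implicit.
Unset Printing Implicit Defensive.

(** * Values of fractions and nonvanishing of polynomials *)

Section FracAt.
Local Open Scope quotient_scope.
Variables (R : realType) (A : idomainType) (ev : {rmorphism A -> R}).
Implicit Types (f g : {fraction A}) (x y : R).

Lemma ev_neq0 a : ev a != 0 -> a != 0.
Proof. by apply: contraNneq => ->; rewrite rmorph0. Qed.

Lemma tofrac_div_eq (N D N' D' : A) : D != 0 -> D' != 0 ->
  tofrac N / tofrac D = tofrac N' / tofrac D' <-> N * D' = N' * D.
Proof.
move=> D0 D'0; split=> [/eqP|e].
  by rewrite eqr_div ?tofrac_eq0 // -!tofracM tofrac_eq => /eqP.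
by apply/eqP; rewrite eqr_div ?tofrac_eq0 // -!tofracM e.
Qed.

(** Two representatives satisfy N D' = N' D; evaluating this identity makes the two values agree. *)
Lemma frac_at_uniq f x y : frac_at ev f x -> frac_at ev f y -> x = y.
Proof.
move=> [N [D [-> D0 ->]]] [N' [D' [e D'0 ->]]].
move/tofrac_div_eq: e => /(_ (ev_neq0 D0) (ev_neq0 D'0)) /(congr1 ev).
by rewrite !rmorphM /= => e; apply/eqP; rewrite eqr_div // e.
Qed.

Lemma frac_at_tofrac a : frac_at ev (tofrac a) (ev a).
Proof.
by exists a, 1; rewrite tofrac1 rmorph1 !divr1 oner_neq0.
Qed.

Lemma frac_atD f g x y :
  frac_at ev f x -> frac_at ev g y -> frac_at ev (f + g) (x + y).
Proof.
move=> [N [D [-> D0 ->]]] [N' [D' [-> D'0 ->]]].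
exists (N * D' + N' * D), (D * D'); split.
- by rewrite addf_div ?tofrac_eq0 ?(ev_neq0 D0) ?(ev_neq0 D'0) // !tofracD !tofracM.
- by rewrite rmorphM mulf_neq0.
- by rewrite addf_div // rmorphD !rmorphM.
Qed.

Lemma frac_atM f g x y :
  frac_at ev f x -> frac_at ev g y -> frac_at ev (f * g) (x * y).
Proof.
move=> [N [D [-> D0 ->]]] [N' [D' [-> D'0 ->]]].
exists (N * N'), (D * D'); split.
- by rewrite mulf_div !tofracM.
- by rewrite rmorphM mulf_neq0.
- by rewrite mulf_div !rmorphM.
Qed.

Lemma frac_at_sum (I : Type) (r : seq I) (F : I -> {fraction A}) (G : I -> R) :
  (forall i, frac_at ev (F i) (G i)) ->
  frac_at ev (\sum_(i <- r) F i) (\sum_(i <- r) G i).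
Proof.
move=> h; elim/big_rec2: _ => [|i y f _ hf]; last exact: frac_atD.
by rewrite -tofrac0 -(rmorph0 ev); exact: frac_at_tofrac.
Qed.

(** Numerator and denominator come from a [ratio] lifting [f]; the equality is checked inside the
    quotient construction, where [tofrac] is unlocked. *)
Lemma fracP f : exists N D : A, D != 0 /\ f = tofrac N / tofrac D.
Proof.
elim/quotW: f => x; exists (\n_x), (\d_x); split; first exact: denom_ratioP.
apply: (canRL (mulfK _)); first by rewrite tofrac_eq0 denom_ratioP.
unlock tofrac; rewrite -[LHS]FracField.pi_mul; apply/eqmodP => /=.
rewrite /FracField.equivf/= !numden_Ratio ?oner_neq0 ?mulr1 ?denom_ratioP //.
by rewrite mulrC.
Qed.

End FracAt.

Section Nonvanishing.
Variable R : realType.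

Lemma poly_nonroot (p : {poly R}) : p != 0 -> exists t, p.[t] != 0.
Proof.
(* The naturals below [size p] are distinct in characteristic 0, and too many to be all roots of
   [p]. *)
move=> p0; pose rs := [seq i%:R : R | i <- iota 0 (size p)].
have urs : uniq rs by rewrite map_inj_uniq ?iota_uniq //; exact: mulrIn (oner_neq0 _).
have [/(max_poly_roots p0)/(_ urs)|] := boolP (all (root p) rs).
  by rewrite size_map size_iota ltnn.
by case/allPn => t _ h; exists t.
Qed.

(** If p and q differed, [w * (p - q)] would be nonzero at some t. This is the passage from generic
    points to polynomial identities in one variable. *)
Lemma poly_eq_generic (w p q : {poly R}) : w != 0 ->
  (forall t, w.[t] != 0 -> p.[t] = q.[t]) -> p = q.
Proof.
move=> w0 h; apply/eqP; rewrite -subr_eq0; apply: contraT => pq0.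
have [t] := poly_nonroot (mulf_neq0 w0 pq0).
rewrite hornerM !hornerE mulf_eq0 negb_or => /andP[/h->].
by rewrite subrr eqxx.
Qed.

Lemma finite_roots (p : {poly R}) : p != 0 -> finite_set [set t | p.[t] = 0].
Proof.
have [k] := ubnP (size p); elim: k p => // k IHk p sp p0.
have [[z pz]|nz] := pselect (exists z, root p z); last first.
  apply: (@sub_finite_set _ _ set0) => [z /= /eqP pz|]; last exact: finite_set0.
  by case: nz; exists z.
have [q pE] := factor_theorem _ _ pz.
have q0 : q != 0 by apply: contraNneq p0 => q0; rewrite pE q0 mul0r.
apply: (@sub_finite_set _ _ ([set t | q.[t] = 0] `|` [set z])); last first.
  rewrite finite_setU; split; last exact: finite_set1.
  by apply: IHk => //; rewrite pE size_Mmonic ?monicXsubC // size_XsubC addn2 in sp.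
move=> t /= /eqP; rewrite pE hornerM mulf_eq0 !hornerE subr_eq0.
by case/orP => /eqP; [left|right].
Qed.

(** [muni] singles out the last variable; every coefficient survives in it, so a nonzero polynomial
    has a nonzero image. *)
Lemma mcoeff_muni n (p : {mpoly R[n.+1]}) (m : 'X_{1..n.+1}) :
  ((muni p)`_(m ord_max))@_[multinom (m (widen_ord (leqnSn n) i)) | i < n]
  = p@_m.
Proof.
rewrite muniE coef_sum [in RHS](mpolyE p) !raddf_sum /=.
apply: eq_bigr => m' _; rewrite coefZ coefXn mcoeffZ mcoeffX.
have [->|m'm] := eqVneq m' m; first by rewrite eqxx mulr1 mcoeffZ mcoeffX eqxx.
have [e|] := eqVneq (m ord_max) (m' ord_max); last first.
  by rewrite !mulr0 mcoeff0.
rewrite mulr1 mcoeffZ mcoeffX; case: eqP => // /mnmP h.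
case/eqP: m'm; apply/mnmP => i; case: (unliftP ord_max i) => [j ->|-> //].
have -> : lift ord_max j = widen_ord (leqnSn n) j.
  by apply: val_inj; rewrite /= /bump leqNgt ltn_ord.
by have:= h j; rewrite !mnmE.
Qed.

Lemma meval_muni n (p : {mpoly R[n.+1]}) (v : 'I_n.+1 -> R) :
  p.@[v] = (map_poly (meval (fun i => v (widen_ord (leqnSn n) i))) (muni p)).[v ord_max].
Proof.
rewrite muniE mevalE raddf_sum horner_sum; apply: eq_bigr => m _.
rewrite big_ord_recr /= map_polyZ map_polyXn hornerZ hornerXn /= mevalZ mevalX mulrA.
by congr (_ * _ * _); apply: eq_bigr => i _; rewrite mnmE.
Qed.

(** Induction on the number of variables: first a point where the leading coefficient in the last
    variable is nonzero, then a value of that variable. *)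
Lemma mpoly_nonvanishing n (p : {mpoly R[n]}) : p != 0 -> exists v, p.@[v] != 0.
Proof.
elim: n p => [|n IHn] p p0.
  exists (fun=> 0); move: p0; rewrite [p]nvar0_mpolyC mevalC.
  by apply: contraNneq => ->; rewrite mpolyC0.
have /IHn[v lv] : lead_coef (muni p) != 0.
  rewrite lead_coef_eq0; apply: contraNneq p0 => p0; apply/eqP/mpolyP => m.
  by rewrite -mcoeff_muni p0 coef0 !mcoeff0.
have /poly_nonroot[t pt] : map_poly (meval v) (muni p) != 0.
  apply: contraNneq lv => p00; rewrite -(coef0 R (size (muni p)).-1) -p00.
  by rewrite coef_map.
exists (fun i => oapp v t (unlift ord_max i)); rewrite meval_muni unlift_none /=.
suff -> : (fun i : 'I_n => oapp v t (unlift ord_max (widen_ord (leqnSn n) i))) = v by [].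
apply/funext => i; suff -> : widen_ord (leqnSn n) i = lift ord_max i by rewrite liftK.
by apply: val_inj; rewrite /= /bump leqNgt ltn_ord.
Qed.

End Nonvanishing.

(** * Evaluation and substitution *)

HB.instance Definition _ (R : realType) m (a : 'cV[R]_m) :=
  GRing.RMorphism.copy (peval a) (meval (fun i => a i 0)).

Section Eval.
Variable R : realType.

Lemma mpoly_neq0_peval m (h : {mpoly R[m]}) :
  h != 0 -> exists a : 'cV_m, peval a h != 0.
Proof.
move=> /mpoly_nonvanishing[v hv]; exists (\col_i v i).
by rewrite /peval (meval_eq (v2 := v)) // => i; rewrite mxE.
Qed.

(** On the whole space a nonzero polynomial has a point where it does not vanish, so only [h != 0]
    has to be carried along. *)
Lemma generically_setT m (P : 'cV[R]_m -> Prop) :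
  generically [set: 'cV[R]_m] P <->
  exists2 h : {mpoly R[m]}, h != 0 & forall a, peval a h != 0 -> P a.
Proof.
split=> [[h [[x _ hx] hP]]|[h h0 hP]].
  exists h; first by apply: contraNneq hx => ->; rewrite rmorph0.
  by move=> a; exact: hP.
exists h; split; last by move=> a _; exact: hP.
by have [a ha] := mpoly_neq0_peval h0; exists a.
Qed.

Lemma peval_neq0 m (a : 'cV[R]_m) h : peval a h != 0 -> h != 0.
Proof. exact: ev_neq0. Qed.

Definition curve_sub m (X : 'cV[{poly R}]_m) (P : {mpoly R[m]}) : {poly R} :=
  mmap polyC (fun i => X i 0) P.

Lemma horner_curve_sub m (X : 'cV[{poly R}]_m) P t :
  (curve_sub X P).[t] = peval (map_mx (horner^~ t) X) P.
Proof.
rewrite /curve_sub /mmap /peval mevalE horner_sum; apply: eq_bigr => i _.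
rewrite hornerM hornerC /mmap1 horner_prod; congr (_ * _).
by apply: eq_bigr => j _; rewrite horner_exp mxE.
Qed.

Definition affine_sub m (M : 'M[R]_m) (c : 'cV[R]_m) (P : {mpoly R[m]}) :
    {mpoly R[m]} :=
  P \mPo [tuple \sum_j M i j *: 'X_j + (c i 0)%:MP | i < m].

Lemma peval_affine_sub m (M : 'M[R]_m) c P x :
  peval x (affine_sub M c P) = peval (M *m x + c) P.
Proof.
rewrite /peval /affine_sub comp_mpoly_meval; apply: meval_eq => i.
rewrite tnth_mktuple mevalD mevalC !mxE raddf_sum /=; congr (_ + _).
by apply: eq_bigr => j _; rewrite mevalZ mevalXU.
Qed.

(** The polynomials P with this property contain the constants and the variables and are closed
    under sums and products. A single exponent on the product of all denominators avoids tracking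
    the degree in each variable. *)
Lemma clear_denominators m n (N D : 'I_n -> {mpoly R[m]}) (P : {mpoly R[n]}) :
  exists (H : {mpoly R[m]}) (M : nat), forall a, (forall i, peval a (D i) != 0) ->
    peval a H = (\prod_i peval a (D i)) ^+ M *
                peval (\col_i (peval a (N i) / peval a (D i))) P.
Proof.
pose ok P := exists (H : {mpoly R[m]}) (M : nat),
  forall a, (forall i, peval a (D i) != 0) ->
    peval a H = (\prod_i peval a (D i)) ^+ M *
                peval (\col_i (peval a (N i) / peval a (D i))) P.
have okC c : ok c%:MP.
  by exists c%:MP, 0%N => a _; rewrite /peval !mevalC mul1r.
have okD P1 P2 : ok P1 -> ok P2 -> ok (P1 + P2).
  move=> [H1 [M1 h1]] [H2 [M2 h2]].
  exists (H1 * (\prod_i D i) ^+ M2 + H2 * (\prod_i D i) ^+ M1), (M1 + M2)%N => a Da.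
  rewrite !rmorphD !rmorphM !rmorphXn !rmorph_prod /= h1 // h2 // exprD; ring.
have okM P1 P2 : ok P1 -> ok P2 -> ok (P1 * P2).
  move=> [H1 [M1 h1]] [H2 [M2 h2]]; exists (H1 * H2), (M1 + M2)%N => a Da.
  by rewrite !rmorphM /= h1 // h2 // exprD; ring.
have okX i : ok 'X_i.
  exists (N i * \prod_(j | j != i) D j), 1%N => a Da.
  rewrite rmorphM rmorph_prod /= expr1 [in RHS](bigD1 i) //=.
  by rewrite [peval _ 'X_i]mevalXU mxE; field; exact: Da.
have okXn i k : ok ('X_i ^+ k).
  by elim: k => [|k IHk]; rewrite ?expr0 -?mpolyC1 // exprS; exact: okM.
elim/mpolyind: P => [|c k P _ _ IHP]; first by rewrite -mpolyC0; exact: okC.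
rewrite -mul_mpolyC; apply: (okD) => //; apply: (okM) => //.
rewrite mpolyXE_id; apply: (big_ind ok) => [|P1 P2|i _].
- by rewrite -mpolyC1.
- exact: okM.
- exact: okXn.
Qed.

Definition pt2 (t s : R) : 'cV[R]_2 := \col_i (if i == 0 then t else s).

Lemma pt2_0 t s : pt2 t s 0 0 = t. Proof. by rewrite mxE. Qed.
Lemma pt2_1 t s : pt2 t s 1 0 = s. Proof. by rewrite mxE. Qed.

Lemma pt2_eta (a : 'cV[R]_2) : a = pt2 (a 0 0) (a 1 0).
Proof.
apply/colP => i; rewrite mxE; case: i => [[|[]]] //= hi.
  by congr (a _ _); apply: val_inj.
by congr (a _ _); apply: val_inj.
Qed.

(** Two kinds of lines in the parameter plane: [row_at] is horizontal, with s frozen; [affine_at] is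
    vertical, with t frozen and the height reparametrized affinely. *)
Definition row_at (s : R) : 'cV[{poly R}]_2 := \col_i (if i == 0 then 'X else s%:P).
Definition affine_at (t l m : R) : 'cV[{poly R}]_2 :=
  \col_i (if i == 0 then t%:P else l *: 'X + m%:P).

Lemma horner_row_at P s t : (curve_sub (row_at s) P).[t] = peval (pt2 t s) P.
Proof.
rewrite horner_curve_sub; congr (peval _ P); apply/colP => i; rewrite !mxE.
by case: ifP; rewrite !hornerE.
Qed.

Lemma horner_affine_at P t l m s :
  (curve_sub (affine_at t l m) P).[s] = peval (pt2 t (l * s + m)) P.
Proof.
rewrite horner_curve_sub; congr (peval _ P); apply/colP => i; rewrite !mxE.
by case: ifP; rewrite !hornerE.
Qed.

End Eval.

(** * Polynomial curves of proportional directions *)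

Section Homogenization.
Variable R : realType.
Implicit Types (P N D : {poly R}).

(* D ^+ n * P(N / D), as a polynomial *)
Definition homogenize n P N D : {poly R} :=
  \sum_(i < n.+1) P`_i *: (N ^+ i * D ^+ (n - i)).

Lemma horner_homogenize n P N D t : (size P <= n.+1)%N -> D.[t] != 0 ->
  (homogenize n P N D).[t] = D.[t] ^+ n * P.[N.[t] / D.[t]].
Proof.
move=> sP Dt; rewrite horner_sum (horner_coef_wide _ sP) mulr_sumr.
apply: eq_bigr => i _; rewrite hornerZ hornerM !horner_exp.
have -> : D.[t] ^+ n = D.[t] ^+ i * D.[t] ^+ (n - i).
  by rewrite -exprD subnKC // -ltnS.
by rewrite expr_div_n; field; rewrite expf_neq0.
Qed.

(** Only the term of index n lacks a factor D. Hence a common divisor of D and the homogenization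
    divides a multiple of [N ^+ n]. *)
Lemma homogenize_mod n P N D : exists K, homogenize n P N D = P`_n *: N ^+ n + D * K.
Proof.
exists (\sum_(i < n) P`_i *: (N ^+ i * D ^+ (n - i).-1)).
rewrite /homogenize big_ord_recr /= subnn mulr1 addrC mulr_sumr; congr (_ + _).
apply: eq_bigr => i _; rewrite -scalerAr mulrCA -exprS prednK //.
by rewrite subn_gt0.
Qed.

(** Degrees are formal bounds here: the top coefficients may vanish, and no case distinction is
    needed. *)
Lemma coefM_top a b (p q : {poly R}) : (size p <= a.+1)%N -> (size q <= b.+1)%N ->
  (size (p * q)%R <= (a + b).+1)%N /\ (p * q)`_(a + b) = p`_a * q`_b.
Proof.
move=> sp sq; split.
  by apply: leq_trans (size_polyMleq _ _) _; rewrite -ltnS;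
     case: (size p + size q)%N (leq_add sp sq); rewrite ?addnS ?addSn.
have la : (a < (a + b).+1)%N by rewrite ltnS leq_addr.
rewrite coefM (bigD1 (Ordinal la)) //= addKn big1 ?addr0 // => i ia.
have [ai|ai] := ltnP a i; first by rewrite nth_default ?mul0r // (leq_trans sp).
rewrite [X in _ * X]nth_default ?mulr0 // (leq_trans sq) //.
have {}ai : (i < a)%N by rewrite ltn_neqAle ai andbT.
by rewrite ltn_subRL ltn_add2r.
Qed.

Lemma coefX_top d n (p : {poly R}) : (size p <= d.+1)%N ->
  (size (p ^+ n)%R <= (n * d).+1)%N /\ (p ^+ n)`_(n * d) = p`_d ^+ n.
Proof.
move=> sp; elim: n => [|n [IHs IHc]]; first by rewrite expr0 size_poly1 coef1.
have [s c] := coefM_top sp IHs.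
by rewrite exprS mulSn s c IHc exprS.
Qed.

(** This is the value at t = oo: the coefficient of formal degree n d is the homogeneous form of P
    at the formal leading coefficients of N and D. These are constants, so the evaluation at 0 is
    harmless. *)
Lemma homogenize_top d n P N D : (size N <= d.+1)%N -> (size D <= d.+1)%N ->
  (size (homogenize n P N D) <= (n * d).+1)%N /\
  (homogenize n P N D)`_(n * d) = (homogenize n P (N`_d)%:P (D`_d)%:P).[0].
Proof.
move=> sN sD.
have top (i : 'I_n.+1) : (size (N ^+ i * D ^+ (n - i))%R <= (n * d).+1)%N /\
    (N ^+ i * D ^+ (n - i))`_(n * d) = N`_d ^+ i * D`_d ^+ (n - i).
  have [s1 c1] := coefX_top i sN; have [s2 c2] := coefX_top (n - i) sD.
  have [] := coefM_top s1 s2.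
  by rewrite -mulnDl subnKC ?c1 ?c2 // -ltnS.
split.
  apply: leq_trans (size_sum _ _ _) _; apply/bigmax_leqP => i _.
  by apply: leq_trans (size_scale_leq _ _) (proj1 (top i)).
rewrite coef_sum horner_sum; apply: eq_bigr => i _.
by rewrite coefZ (proj2 (top i)) -!rmorphXn -rmorphM hornerZ hornerC.
Qed.

Lemma size2_polyE (p : {poly R}) : (size p <= 2)%N -> p = p`_1 *: 'X + (p`_0)%:P.
Proof.
move=> sp; apply/polyP => i; rewrite coefD coefZ coefX coefC.
case: i => [|[|i]] /=; rewrite ?mulr0 ?mulr1 ?addr0 ?add0r //.
by rewrite nth_default // (leq_trans sp).
Qed.

End Homogenization.

(** * Coprime triples of polynomials and the degree count *)

Section Directions.
Variable R : realType.
Implicit Types (q : 'cV[{poly R}]_3).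

Lemma Bezout_gcdp (p q : {poly R}) : exists u v, u * p + v * q = gcdp p q.
Proof.
have [[u v] /=] := Bezoutp p q; rewrite eqp_sym => /eqpf_eq[c c0 ->].
by exists (c *: u), (c *: v); rewrite scalerDr !scalerAl.
Qed.

(** The Bezout form of coprimality is the one that can be evaluated at a point, transported by a
    matrix and homogenized. *)
Lemma coprime_dirP q :
  coprime_dir q <-> exists u : 'I_3 -> {poly R}, \sum_j u j * q j 0 = 1.
Proof.
rewrite /coprime_dir; split=> [cq|[u uq]]; last first.
  rewrite -size_poly_eq1 -dvdp1 -uq; apply: (big_ind (fun x => _ %| x)); rewrite ?dvdp0 //.
    by move=> x y; exact: dvdp_add.
  move=> j _; apply: dvdp_mull; case: j => [[|[|[]]]] //= hj.
  - have -> : Ordinal hj = 0 by apply: val_inj.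
    by rewrite (dvdp_trans (dvdp_gcdl _ _)) ?dvdp_gcdl.
  - have -> : Ordinal hj = 1 by apply: val_inj.
    by rewrite (dvdp_trans (dvdp_gcdl _ _)) ?dvdp_gcdr.
  - have -> : Ordinal hj = 2 by apply: val_inj.
    exact: dvdp_gcdr.
have [v1 [v2 e12]] := Bezout_gcdp (q 0 0) (q 1 0).
have [v3 [v4 e34]] := Bezout_gcdp (gcdp (q 0 0) (q 1 0)) (q 2 0).
have /eqpf_eq[c c0 gc] := cq.
(* The Bezout coefficients of the two nested gcds, divided by the constant [c] that the outer gcd
   equals. *)
exists (fun j => c^-1 *: [eta (fun=> 0) with 0 |-> v3 * v1, 1 |-> v3 * v2, 2 |-> v4] j).
rewrite !big_ord_recl big_ord0 /=.
rewrite -!scalerAl addr0 -!scalerDr.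
apply: (scalerI c0); rewrite scalerA mulfV // scale1r -gc -e34 -e12.
have -> : lift ord0 ord0 = 1 :> 'I_3 by apply: val_inj.
have -> : lift ord0 (lift ord0 ord0) = 2 :> 'I_3 by apply: val_inj.
have -> : ord0 = 0 :> 'I_3 by apply: val_inj.
by ring.
Qed.

Lemma dir_at_neq0 q t : coprime_dir q -> exists j, (q j 0).[t] != 0.
Proof.
move=> /coprime_dirP[u /(congr1 (horner^~ t))].
rewrite hornerC horner_sum => e; apply/existsP; apply: contraT => /existsPn h.
move/eqP: e; rewrite big1 ?(eq_sym 0) ?oner_eq0 // => j _.
by rewrite hornerM; have /negPn/eqP-> := h j; rewrite mulr0.
Qed.

Lemma leq_dir_degree q j : (size (q j 0%R) <= (dir_degree q).+1)%N.
Proof.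
apply: leq_trans (leqSpred _) _; rewrite ltnS.
exact: (@leq_bigmax 'I_3 (fun j => (size (q j 0%R)).-1)).
Qed.

Lemma dir_degree_attained q : exists j, (size (q j 0%R)).-1 = dir_degree q.
Proof.
have [|j e] := @bigop.eq_bigmax 'I_3 (fun j => (size (q j 0%R)).-1).
  by rewrite card_ord.
by exists j; rewrite /dir_degree e.
Qed.

Section Proportional.
Variables (n : nat) (q1 q2 : 'cV[{poly R}]_3) (N D w : {poly R}).
Hypotheses (n0 : (0 < n)%N) (cop1 : coprime_dir q1) (cop2 : coprime_dir q2).
Hypotheses (deg1 : dir_degree q1 = n) (deg2 : dir_degree q2 = n).
Hypotheses (w0 : w != 0) (copND : coprimep N D).
Hypothesis prop : forall t, w.[t] != 0 -> D.[t] != 0 /\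
  exists l, dir_at q1 t = l *: dir_at q2 (N.[t] / D.[t]).

Let Q j := homogenize n (q2 j 0) N D.

Let size_q2 j : (size (q2 j 0%R) <= n.+1)%N.
Proof. by rewrite -deg2 leq_dir_degree. Qed.

(** Positivity of n excludes the zero polynomial, whose degree also counts as 0 in [dir_degree]. *)
Let q2_lead : exists j, (q2 j 0)`_n != 0.
Proof.
have [j ej] := dir_degree_attained q2; exists j.
rewrite -deg2 -ej -lead_coefE lead_coef_eq0; apply: contraTneq n0 => e.
by rewrite -deg2 -ej e size_poly0.
Qed.

(** If Q = E q1, a Bezout identity for q1 forces E to be the combination of the [Q j] with the same
    coefficients. At generic t one has l Q = D^n q1 with l nonzero, which confirms this choice. *)
Lemma homogenize_factor : exists E, forall j, Q j = E * q1 j 0.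
Proof.
have [u u1] := (coprime_dirP q1).1 cop1.
exists (\sum_j u j * Q j) => j; apply: (poly_eq_generic w0) => t /prop[Dt [l e]].
have eQ i : l * (Q i).[t] = D.[t] ^+ n * (q1 i 0).[t].
  rewrite horner_homogenize //; have /colP/(_ i) := e; rewrite !mxE => ->; ring.
have := congr1 (horner^~ t) u1; rewrite hornerC => {}u1.
have lE : l * (\sum_j u j * Q j).[t] = D.[t] ^+ n.
  rewrite -[RHS]mulr1 -u1 !horner_sum !mulr_sumr; apply: eq_bigr => i _.
  by rewrite !hornerM mulrCA eQ mulrCA.
have l0 : l != 0.
  by apply: contra_eq_neq lE => ->; rewrite mul0r eq_sym expf_neq0.
by apply: (mulfI l0); rewrite hornerM mulrA lE eQ.
Qed.

(** Homogenizing a Bezout identity for q2 shows that E divides a power of D. Yet E is coprime to D,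
    since a common divisor would divide a nonzero multiple of [N ^+ n]. *)
Lemma homogenize_factor_unit E : (forall j, Q j = E * q1 j 0) -> size E = 1%N.
Proof.
move=> QE; have dE j : E %| Q j by rewrite QE dvdp_mulr.
have [u u1] := (coprime_dirP q2).1 cop2.
pose M := (\max_j size (u j))%N.
have su j : (size (u j) <= M.+1)%N.
  by rewrite leqW // (@leq_bigmax 'I_3 (fun j => size (u j))).
have bez : \sum_j homogenize M (u j) N D * Q j = D ^+ (M + n).
  apply: (poly_eq_generic w0) => t /prop[Dt _].
  have := congr1 (horner^~ (N.[t] / D.[t])) u1; rewrite hornerC => {}u1.
  rewrite horner_exp -[RHS]mulr1 -u1 !horner_sum mulr_sumr.
  apply: eq_bigr => i _; rewrite !hornerM !horner_homogenize // exprD; ring.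
have EDM : E %| D ^+ (M + n).
  rewrite -bez; apply: (big_ind (fun x => E %| x)) => [|x y|j _]; rewrite ?dvdp0 //.
    exact: dvdp_add.
  exact: dvdp_mull.
have copED : coprimep E D.
  apply/coprimepP => e eE eD; have [j qj] := q2_lead.
  have [K] := homogenize_mod n (q2 j 0) N D; rewrite -/(Q j) => QK.
  have : e %| (q2 j 0)`_n *: N ^+ n.
    by rewrite -(dvdp_addl _ (dvdp_mulr K eD)) -QK (dvdp_trans eE).
  rewrite dvdpZr // => eN.
  have /coprimepP : coprimep (N ^+ n) D by apply: coprimep_expl.
  exact.
apply/eqP; rewrite size_poly_eq1.
by have /coprimepP := coprimep_expr (M + n) copED; apply.
Qed.

Lemma proportional_mobius : exists alpha beta gamma delta k : R,
  [/\ alpha * delta - beta * gamma != 0, N = alpha *: 'X + beta%:P,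
      D = gamma *: 'X + delta%:P &
      forall t, D.[t] != 0 ->
        dir_at q1 t = (k * D.[t] ^+ n) *: dir_at q2 (N.[t] / D.[t])].
Proof.
have [E QE] := homogenize_factor; have sE := homogenize_factor_unit QE.
have [e e0 Ee] : exists2 e, e != 0 & E = e%:P.
  by move/eqP: sE => /size_poly1P[e e0 ->]; exists e.
pose d := (maxn (size N) (size D)).-1.
have sN : (size N <= d.+1)%N.
  by rewrite (leq_trans _ (leqSpred _)) // leq_maxl.
have sD : (size D <= d.+1)%N.
  by rewrite (leq_trans _ (leqSpred _)) // leq_maxr.
have D0 : D != 0.
  have [t /prop[Dt _]] := poly_nonroot w0; apply: contraNneq Dt => ->.
  by rewrite horner0.
have sizeq1 j : size (q1 j 0%R) = size (Q j).
  by rewrite QE Ee mul_polyC size_scale.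
have d1 : (d <= 1)%N.
  (* The triple Q attains its formal degree n d: its coefficients there are the homogenized q2 at
     the projective point (N_d : D_d), where they do not all vanish. The case D_d = 0 is the point
     at infinity, governed by the leading coefficients of q2. *)
  have [j Qj] : exists j, (Q j)`_(n * d) != 0.
    have [Dd|Dd] := eqVneq D`_d 0.
      have [j qj] := q2_lead; exists j; rewrite (homogenize_top _ _ sN sD).2 Dd.
      have [K ->] := homogenize_mod n (q2 j 0) (N`_d)%:P 0.
      rewrite mul0r addr0 -rmorphXn hornerZ hornerC mulf_neq0 // expf_neq0 //.
      move: Dd; rewrite /d; have [ND|/ltnW DN] := leqP (size N) (size D).
        by rewrite -lead_coefE => /eqP; rewrite lead_coef_eq0 (negbTE D0).
      rewrite -lead_coefE lead_coef_eq0 => _; apply: contraNneq D0 => N0.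
      by rewrite N0 size_poly0 leqn0 size_poly_eq0 in DN.
    have [j qj] := dir_at_neq0 (N`_d / D`_d) cop2; exists j.
    rewrite (homogenize_top _ _ sN sD).2 horner_homogenize ?hornerC //.
    by rewrite mulf_neq0 ?expf_neq0.
  rewrite -(leq_pmul2l n0) muln1 -ltnS -deg1 (leq_trans _ (leq_dir_degree q1 j)) //.
  by rewrite sizeq1 deg1 ltnNge; apply: contra Qj => /leq_sizeP/(_ _ (leqnn _))->.
have sN2 : (size N <= 2)%N by rewrite (leq_trans sN).
have sD2 : (size D <= 2)%N by rewrite (leq_trans sD).
have NE := size2_polyE sN2; have DE := size2_polyE sD2.
(* Since Q = e q1, the constant k is the inverse of [e]. *)
exists N`_1, N`_0, D`_1, D`_0, e^-1; split; [|exact: NE|exact: DE|].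
  (* A zero determinant gives D_1 N = N_1 D; coprimality then forces D_1 = N_1 = 0, so N, D and
     hence q1 are constant, against n > 0. *)
  apply/negP => /eqP det0.
  have ND : D`_1 *: N = N`_1 *: D.
    rewrite [N in LHS]NE [D in RHS]DE !scalerDr !scalerA mulrC; congr (_ + _).
    by rewrite -!mul_polyC -!rmorphM (subr0_eq det0) mulrC.
  have D1 : D`_1 = 0.
    apply/eqP; apply: contraT => D1.
    have DN : D %| N by rewrite -(dvdpZr _ _ D1) ND -mul_polyC dvdp_mull.
    have /coprimepP/(_ _ DN (dvdpp _)) := copND.
    by rewrite -size_poly_eq1 => /eqP sD1; rewrite nth_default ?sD1 ?eqxx in D1.
  have N1 : N`_1 = 0.
    by move: ND; rewrite D1 scale0r => /esym/eqP; rewrite scaler_eq0 (negbTE D0) orbF => /eqP.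
  have sz1 (p : {poly R}) : (size p <= 2)%N -> p`_1 = 0 -> (size p <= 1)%N.
    by move=> /size2_polyE {2}-> ->; rewrite scale0r add0r size_polyC_leq1.
  have [j ej] := dir_degree_attained q1; move: n0; rewrite -deg1 -ej sizeq1.
  have [s _] := homogenize_top n (q2 j 0) (sz1 _ sN2 N1) (sz1 _ sD2 D1).
  by rewrite muln0 in s; case: (size _) s => [|[]].
move=> t Dt; apply/colP => j; rewrite !mxE.
have := congr1 (horner^~ t) (QE j); rewrite horner_homogenize // Ee hornerM hornerC.
by move=> h; apply: (mulfI e0); rewrite -h; field.
Qed.

End Proportional.

End Directions.

(** * Rulings and affine images *)

Section Lines.
Variable R : realType.
Implicit Types (u v : 'cV[R]_3) (p : 'cV[{fraction {poly R}}]_3) (q : 'cV[{poly R}]_3).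

Definition line u v : set 'cV[R]_3 := range (fun s : R => u + s *: v).

(** The points of parameters 0 and 1 on the smaller line determine m and l. *)
Lemma line_sub u v u' v' : line u' v' `<=` line u v ->
  exists l m, v' = l *: v /\ u' = u + m *: v.
Proof.
move=> h; have [|m _ em] := h u'; first by exists 0; rewrite // scale0r addr0.
have [|l _ el] := h (u' + v'); first by exists 1; rewrite // scale1r.
exists (l - m), m; split=> //; apply: (addrI u').
by rewrite -el -em scalerBl -addrA [m *: v + _]addrC subrK.
Qed.

(** The form in which non-cylindricity is used: a fixed direction is met for finitely many t only,
    with a polynomial as witness. *)
Definition moving_dir q := forall v, v != 0 ->
  exists2 w : {poly R}, w != 0 &
    forall t, w.[t] != 0 -> ~ exists l, dir_at q t = l *: v.

(** The polynomial is a 2 by 2 minor of the matrix (q, v). If all minors vanish identically, every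
    q(t) is a nonzero multiple of v by coprimality, and any two rulings differ by a translation. *)
Lemma noncylindrical_moving_dir p q :
  coprime_dir q -> ~ cylindrical p q -> moving_dir q.
Proof.
move=> cq ncyl v v0.
pose c i j := q i 0 * (v j 0)%:P - q j 0 * (v i 0)%:P.
have [[i [j cij]]|nc] := pselect (exists i j, c i j != 0).
  exists (c i j) => // t + [l /colP e]; rewrite /c !hornerE.
  have := e i; have := e j; rewrite !mxE => -> ->.
  by rewrite (_ : _ - _ = 0) ?eqxx //; ring.
case: ncyl; have [j vj] : exists j, v j 0 != 0.
  apply/existsP; apply: contraT => /existsPn h; case/eqP: v0.
  by apply/colP => j; rewrite mxE; apply/eqP/negPn/h.
have par t : exists2 l, l != 0 & dir_at q t = l *: v.
  have e : dir_at q t = ((q j 0).[t] / v j 0) *: v.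
    apply/colP => i; rewrite !mxE; have /eqP : c i j = 0.
      by apply/eqP; apply: contraT => cij; case: nc; exists i, j.
    rewrite subr_eq0 => /eqP/(congr1 (horner^~ t)); rewrite !hornerM !hornerC => ee.
    by rewrite mulrAC -ee mulfK.
  exists ((q j 0).[t] / v j 0) => //; have [i] := dir_at_neq0 t cq.
  apply: contraNneq => l0; have /colP/(_ i) := e.
  by rewrite l0 scale0r !mxE => ->.
move=> _ _ [t [u [_ ->]]] [t' [u' [_ ->]]]; exists (u' - u).
have [l l0 ->] := par t; have [l' l'0 ->] := par t'.
apply/seteqP; split=> x /=.
  move=> [s _ <-]; exists (u + (s * l' / l) *: (l *: v)).
    by exists (s * l' / l).
  by rewrite !scalerA divfK // addrC addrA subrK.
move=> [_ [s _ <-] <-]; exists (s * l / l') => //.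
by rewrite !scalerA divfK // [RHS]addrC addrA subrK.
Qed.

(** If L is the line at some t0, every parameter giving L has direction parallel to q(t0), which a
    moving direction allows for finitely many t only. *)
Lemma avoid_ruling q (L : set 'cV[R]_3) : coprime_dir q -> moving_dir q ->
  exists2 w : {poly R}, w != 0 &
    forall t u, w.[t] != 0 -> line u (dir_at q t) <> L.
Proof.
move=> cq mq; have [[t0 [u0 e0]]|n] := pselect (exists t u, line u (dir_at q t) = L);
    last first.
  by exists 1; [exact: oner_neq0 | move=> t u _ e; apply: n; exists t, u].
have v0 : dir_at q t0 != 0.
  have [j] := dir_at_neq0 t0 cq; apply: contraNneq => /colP/(_ j).
  by rewrite !mxE => ->.
have [w w0 h] := mq _ v0; exists w => // t u wt; rewrite -e0 => e.
have [|l [m [el _]]] := @line_sub u0 (dir_at q t0) u (dir_at q t); first by rewrite e.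
by apply: (h t wt); exists l.
Qed.

Lemma avoid_rulings q (F : set (set 'cV[R]_3)) : coprime_dir q -> moving_dir q ->
  finite_set F -> exists2 w : {poly R}, w != 0 &
    forall t u, w.[t] != 0 -> ~ F (line u (dir_at q t)).
Proof.
move=> cq mq /finite_seqP[s ->]; elim: s => [|L s [w w0 h]].
  by exists 1; [exact: oner_neq0 | move=> t u _].
have [w' w'0 h'] := avoid_ruling L cq mq.
exists (w * w'); first exact: mulf_neq0.
move=> t u; rewrite hornerM mulf_eq0 negb_or => /andP[/h ht /h' h't] /=.
by rewrite inE => /orP[/eqP/h't|/ht].
Qed.

Lemma ratcurve_at_uniq p t u u' : ratcurve_at p t u -> ratcurve_at p t u' -> u = u'.
Proof.
move=> h h'; apply/colP => j; exact: (@frac_at_uniq _ _ (horner_eval t) _ _ _ (h j) (h' j)).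
Qed.

Lemma ratcurve_at_generic p : exists2 w : {poly R}, w != 0 &
  forall t, w.[t] != 0 -> exists u, ratcurve_at p t u.
Proof.
have /choice[ND h] : forall j, exists ND : {poly R} * {poly R},
    ND.2 != 0 /\ p j 0 = tofrac ND.1 / tofrac ND.2.
  by move=> j; have [N [D e]] := fracP (p j 0); exists (N, D).
exists (\prod_j (ND j).2); first by apply/prodf_neq0 => j _; case: (h j).
move=> t; rewrite horner_prod => /prodf_neq0 ht.
exists (\col_j ((ND j).1.[t] / (ND j).2.[t])) => j.
by exists (ND j).1, (ND j).2; rewrite mxE ht //; case: (h j).
Qed.

Lemma ruled_at_uniq p q a y y' : ruled_at p q a y -> ruled_at p q a y' -> y = y'.
Proof. by move=> [u hu ->] [u' hu' ->]; rewrite (ratcurve_at_uniq hu hu'). Qed.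

End Lines.

(** * Transport of ruled parametrizations by affine isomorphisms *)

Section AffineImage.
Variables (R : realType) (A : 'M[R]_3) (b : 'cV[R]_3).
Implicit Types (p : 'cV[{fraction {poly R}}]_3) (q : 'cV[{poly R}]_3).

Definition affine_dir q : 'cV[{poly R}]_3 := map_mx polyC A *m q.

(** Together with [affine_dir A q] this parametrizes the image under x |-> A x + b, ruling by
    ruling. *)
Definition affine_base p : 'cV[{fraction {poly R}}]_3 :=
  map_mx (@tofrac _ \o polyC) A *m p + map_mx (@tofrac _ \o polyC) b.

Lemma dir_at_affine q t : dir_at (affine_dir q) t = A *m dir_at q t.
Proof.
apply/colP => j; rewrite !mxE horner_sum; apply: eq_bigr => i _.
by rewrite !mxE hornerM hornerC.
Qed.

Lemma ratcurve_at_affine p t u :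
  ratcurve_at p t u -> ratcurve_at (affine_base p) t (A *m u + b).
Proof.
move=> hu j; rewrite /affine_base !mxE.
have ev c : frac_at (horner_eval t) (tofrac c%:P) c.
  by rewrite -[X in frac_at _ _ X](hornerC c t); exact: (frac_at_tofrac (horner_eval t)).
apply: (@frac_atD _ _ (horner_eval t)); last exact: ev.
apply: (@frac_at_sum _ _ (horner_eval t)) => i.
by apply: (@frac_atM _ _ (horner_eval t)) => //; [rewrite mxE; exact: ev|exact: hu].
Qed.

End AffineImage.

Section AffineTransport.
Variables (R : realType) (A : 'M[R]_3) (b : 'cV[R]_3) (uA : A \in unitmx).
Variables (p : 'cV[{fraction {poly R}}]_3) (q : 'cV[{poly R}]_3).

Let f x := A *m x + b.
Let f' x := invmx A *m x + - (invmx A *m b).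
Let p' := affine_base A b p.
Let q' := affine_dir A q.

Lemma affineK : cancel f f'.
Proof. by move=> x; rewrite /f /f' mulmxDr mulKmx // addrK. Qed.

Lemma affineVK : cancel f' f.
Proof. by move=> x; rewrite /f /f' mulmxDr mulmxN !mulKVmx // subrK. Qed.

Lemma affine_baseK : affine_base (invmx A) (- (invmx A *m b)) p' = p.
Proof.
rewrite /p' /affine_base mulmxDr mulmxA -!map_mxM mulVmx // map_mx1 mul1mx.
by rewrite map_mxN addrK.
Qed.

Lemma ratcurve_at_affineE t u : ratcurve_at p' t (f u) <-> ratcurve_at p t u.
Proof.
split=> [h|]; last exact: ratcurve_at_affine.
have := ratcurve_at_affine (invmx A) (- (invmx A *m b)) h.
by rewrite affine_baseK -/(f' _) affineK.
Qed.

Lemma ruled_at_affine a y : ruled_at p' q' a (f y) <-> ruled_at p q a y.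
Proof.
split=> [[u hu e]|[u hu ->]].
  exists (f' u); first by apply/ratcurve_at_affineE; rewrite affineVK.
  rewrite -[y]affineK e dir_at_affine /f' mulmxDr -scalemxAr mulKmx //.
  by rewrite addrAC.
exists (f u); first exact/ratcurve_at_affineE.
by rewrite dir_at_affine /f mulmxDr -scalemxAr addrAC.
Qed.

Lemma coprime_affine_dir : coprime_dir q -> coprime_dir q'.
Proof.
move=> /coprime_dirP[u u1]; apply/coprime_dirP.
(* The row of Bezout coefficients is multiplied by the inverse of A. *)
exists (fun k => \sum_j u j * (invmx A j k)%:P); rewrite -u1.
have qE : q = map_mx polyC (invmx A) *m q'.
  by rewrite mulmxA -map_mxM mulVmx // map_mx1 mul1mx.
under eq_bigr => k _ do rewrite mulr_suml.
rewrite exchange_big; apply: eq_bigr => j _.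
rewrite [in RHS]qE [in RHS]mxE mulr_sumr.
by apply: eq_bigr => k _; rewrite [map_mx _ _ _ _]mxE mulrA.
Qed.

Lemma moving_affine_dir : moving_dir q -> moving_dir q'.
Proof.
move=> mq v v0; have [|w w0 h] := mq (invmx A *m v).
  apply: contraNneq v0 => e; rewrite -[v](mulKVmx uA) e mulmx0 //.
exists w => // t /h nl [l]; rewrite dir_at_affine => e; apply: nl; exists l.
by rewrite scalemxAr -e mulKmx.
Qed.

(** Polynomials vanishing on one image pull back along f or its inverse to polynomials vanishing on
    the other, so Zariski closure commutes with f. *)
Lemma ruled_surface_affine : ruled_surface p' q' = f @` ruled_surface p q.
Proof.
apply/seteqP; split=> [y yS|_ [x xS <-] P hP].
  exists (f' y); last exact: affineVK.
  move=> P hP; rewrite -peval_affine_sub; apply: yS => z [a].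
  rewrite -[z]affineVK => /ruled_at_affine h.
  by rewrite peval_affine_sub -/(f' _) affineVK; apply: hP; exists a.
rewrite -peval_affine_sub; apply: xS => z [a h].
by rewrite peval_affine_sub; apply: hP; exists a; apply/ruled_at_affine.
Qed.

(** The composite of g with the inverse of f. It is defined by one choice of fractions, while the
    value of g at x may come from another representative; cross multiplication relates the two. *)
Lemma ratmap_precomp_affine (g : ratmap R 3 2) : exists g' : ratmap R 3 2,
  forall x a, ratmap_at g x a -> ratmap_at g' (f x) a.
Proof.
pose sb := affine_sub (invmx A) (- (invmx A *m b)).
have sbE x P : peval (f x) (sb P) = peval x P.
  by rewrite peval_affine_sub -/(f' _) affineK.
have /choice[ND h] : forall j, exists ND : {mpoly R[3]} * {mpoly R[3]},
    ND.2 != 0 /\ g j 0 = tofrac ND.1 / tofrac ND.2.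
  by move=> j; have [N [D e]] := fracP (g j 0); exists (N, D).
exists (\col_j (tofrac (sb (ND j).1) / tofrac (sb (ND j).2))) => x a gxa j.
have [N [D [e Dx ->]]] := gxa j; have [D0 e'] := h j.
exists (sb N), (sb D); rewrite !sbE mxE; split=> //.
have sbD0 P : P != 0 -> sb P != 0.
  move=> /mpoly_neq0_peval[y]; rewrite -sbE; exact: peval_neq0.
apply/tofrac_div_eq; rewrite ?sbD0 ?(peval_neq0 Dx) //.
have DD : (ND j).1 * D = N * (ND j).2.
  by apply/tofrac_div_eq; rewrite -?e' ?e ?(peval_neq0 Dx).
by rewrite /sb /affine_sub -!rmorphM /= DD.
Qed.

Lemma proper_param_affine : proper_param p q -> proper_param p' q'.
Proof.
move=> [g [[h [[a0 _ ha0] hP]] [k [[x0 x0S kx0] kP]]]].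
have [g' gg'] := ratmap_precomp_affine g; exists g'; rewrite ruled_surface_affine.
split.
  exists h; split; first by exists a0.
  move=> a _ /(hP _ I)[x [xS ax gxa]]; exists (f x); split; [by exists x| |exact: gg'].
  exact/ruled_at_affine.
exists (affine_sub (invmx A) (- (invmx A *m b)) k).
have kE x : peval (f x) (affine_sub (invmx A) (- (invmx A *m b)) k) = peval x k.
  by rewrite peval_affine_sub -/(f' _) affineK.
split; first by exists (f x0); [exists x0|rewrite kE].
move=> _ [x xS <-]; rewrite kE => /(kP _ xS)[a [_ gxa ax]].
exists a; split=> //; [exact: gg'|exact/ruled_at_affine].
Qed.

End AffineTransport.

(** * The action of phi on the parameters *)

Section Correspondence.
Variable R : realType.
Implicit Types (p : 'cV[{fraction {poly R}}]_3) (q : 'cV[{poly R}]_3).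

Lemma horner_neq0 (P : {poly R}) t : P.[t] != 0 -> P != 0.
Proof. by apply: contraNneq => ->; rewrite horner0. Qed.

Lemma ratmap_at_uniq m n (g : ratmap R m n) a y y' :
  ratmap_at g a y -> ratmap_at g a y' -> y = y'.
Proof.
move=> h h'; apply/colP => j; exact: (@frac_at_uniq _ _ (peval a) _ _ _ (h j) (h' j)).
Qed.

(** The rational inverse recovers both parameters as its unique value at y. *)
Lemma proper_generic_injective p q : proper_param p q ->
  exists2 h : {mpoly R[2]}, h != 0 & forall a a' y, peval a h != 0 -> peval a' h != 0 ->
    ruled_at p q a y -> ruled_at p q a' y -> a = a'.
Proof.
move=> [g [/generically_setT[h h0 hP] _]]; exists h => // a a' y.
move=> /hP[z [_ az gza]] /hP[z' [_ a'z gza']] ay a'y; move: gza gza'.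
rewrite (ruled_at_uniq az ay) (ruled_at_uniq a'z a'y); exact: ratmap_at_uniq.
Qed.

Lemma poly_lift (w : {poly R}) : w != 0 -> exists2 W : {mpoly R[2]}, W != 0 &
  forall a, peval a W = w.[a 0 0].
Proof.
move=> w0; pose W : {mpoly R[2]} := (map_poly (@mpolyC 2 R) w).['X_0].
have WE a : peval a W = w.[a 0 0].
  rewrite /W -[LHS](horner_map (peval a)) /= -map_poly_comp.
  have -> : peval a 'X_0 = a 0 0 by rewrite /peval mevalXU.
  by rewrite map_poly_id // => x _ /=; rewrite /peval mevalC.
exists W => //; have [t wt] := poly_nonroot w0.
by apply: (@peval_neq0 _ _ (pt2 t 0)); rewrite WE pt2_0.
Qed.

Lemma dir_degree_affine_leq (A : 'M[R]_3) q :
  (dir_degree (affine_dir A q) <= dir_degree q)%N.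
Proof.
apply/bigmax_leqP => j _; rewrite -ltnS.
have [|j0] := posnP (size (affine_dir A q j 0%R)); first by move=> ->.
rewrite prednK // mxE; apply: leq_trans (size_sum _ _ _) _.
apply/bigmax_leqP => i _; rewrite mxE mul_polyC.
by apply: leq_trans (size_scale_leq _ _) _; exact: leq_dir_degree.
Qed.

Lemma dir_degree_affine (A : 'M[R]_3) q : A \in unitmx ->
  dir_degree (affine_dir A q) = dir_degree q.
Proof.
move=> uA; apply/eqP; rewrite eqn_leq dir_degree_affine_leq.
have {1}-> : q = affine_dir (invmx A) (affine_dir A q).
  by rewrite /affine_dir mulmxA -map_mxM mulVmx // map_mx1 mul1mx.
exact: dir_degree_affine_leq.
Qed.

(** In degree 0 the vector q is constant, and the fixed direction q(0) is met at every t. *)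
Lemma moving_dir_degree q : coprime_dir q -> moving_dir q -> (0 < dir_degree q)%N.
Proof.
move=> cq mq; rewrite lt0n; apply/eqP => d0.
have qC j : q j 0 = ((q j 0)`_0)%:P.
  by apply: size1_polyC; have := leq_dir_degree q j; rewrite d0.
have [|w w0 h] := mq (dir_at q 0).
  have [j] := dir_at_neq0 0 cq; apply: contraNneq => /colP/(_ j).
  by rewrite !mxE => ->.
have [t wt] := poly_nonroot w0; case: (h t wt); exists 1.
by rewrite scale1r; apply/colP => j; rewrite !mxE qC !hornerC.
Qed.

Variables (p1 p2 : 'cV[{fraction {poly R}}]_3) (q1 q2 : 'cV[{poly R}]_3).
Variables (A : 'M[R]_3) (b : 'cV[R]_3).
Hypotheses (proper1 : proper_param p1 q1) (proper2 : proper_param p2 q2).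
Hypothesis ndr2 : ~ doubly_ruled (ruled_surface p2 q2).
Hypotheses (mov1 : moving_dir q1) (cop1 : coprime_dir q1) (cop2 : coprime_dir q2).
Hypothesis A_unit : A \in unitmx.
Hypothesis fS : [set A *m x + b | x in ruled_surface p1 q1] = ruled_surface p2 q2.

(** The image rulings and the given ones are both ruling families of S2, so all but finitely many
    image lines are given rulings, and t only has to avoid finitely many lines. The last clause
    keeps h from vanishing identically over tau, so that generic injectivity can be applied on that
    ruling. *)
Lemma rulings_correspond (h : {mpoly R[2]}) : h != 0 ->
  exists2 w : {poly R}, w != 0 & forall t, w.[t] != 0 -> exists u u2 tau l m,
    [/\ ratcurve_at p1 t u, ratcurve_at p2 tau u2, l != 0 &
      [/\ A *m dir_at q1 t = l *: dir_at q2 tau,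
          A *m u + b = u2 + m *: dir_at q2 tau &
          exists s, peval (pt2 tau s) h != 0]].
Proof.
move=> h0; have [a0 ha0] := mpoly_neq0_peval h0.
pose p' := affine_base A b p1; pose q' := affine_dir A q1.
have cop' : coprime_dir q' by apply: coprime_affine_dir.
have [finF _] : same_family (rulings p' q') (rulings p2 q2).
  apply: contrapT => nsf; apply: ndr2; exists (rulings p' q'), (rulings p2 q2).
  split=> //; [exists p', q'|by exists p2, q2]; split=> //.
    exact: proper_param_affine.
  by rewrite ruled_surface_affine.
pose c := curve_sub (row_at (a0 1 0)) h.
have c0 : c != 0.
  by apply: (@horner_neq0 _ (a0 0 0)); rewrite /c horner_row_at -pt2_eta.
(* The rulings of S2 at the finitely many tau with h(tau, s0) = 0, where s0 is the second coordinate
   of [a0]. At a pole of p2 the default base point 0 only adds a harmless line. *)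
pose G := (fun tau => line (xget 0 [set u | ratcurve_at p2 tau u]) (dir_at q2 tau))
  @` [set tau | c.[tau] = 0].
have finG : finite_set G by apply: finite_image; exact: finite_roots.
have [||w w0 hw] := @avoid_rulings _ q' (rulings p' q' `\` rulings p2 q2 `|` G) cop'.
- exact: moving_affine_dir.
- by rewrite finite_setU.
have [w' w'0 hw'] := ratcurve_at_generic p1.
exists (w * w'); first exact: mulf_neq0.
move=> t; rewrite hornerM mulf_eq0 negb_or => /andP[wt /hw'[u pu]].
have hu := hw t (A *m u + b) wt.
have [tau [u2 [pu2 eL]]] : rulings p2 q2 (line (A *m u + b) (dir_at q' t)).
  apply: contrapT => nr; apply: hu; left; split=> //.
  by exists t, (A *m u + b); split=> //; exact: ratcurve_at_affine.
have [|l [m [el em]]] := @line_sub _ u2 (dir_at q2 tau) (A *m u + b) (dir_at q' t).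
  by rewrite eL.
exists u, u2, tau, l, m; split=> //; last split=> //.
- have [j] := dir_at_neq0 t cop'; apply: contraNneq => l0.
  by move/colP: el => /(_ j); rewrite l0 scale0r !mxE => ->.
- by rewrite -dir_at_affine.
exists (a0 1 0); rewrite -horner_row_at -/c; apply/eqP => ct.
apply: hu; right; exists tau => //; rewrite eL.
suff -> : xget 0 [set u | ratcurve_at p2 tau u] = u2 by [].
apply: (ratcurve_at_uniq _ pu2).
by apply: (@xgetPex _ 0 [set u | ratcurve_at p2 tau u]); exists u2.
Qed.

Variable phi : ratmap R 2 2.
Hypothesis phi_birational : birational [set: 'cV[R]_2] [set: 'cV[R]_2] (ratmap_at phi).
Hypothesis phi_comm : generically [set: 'cV[R]_2] (fun a =>
  exists x a', [/\ ruled_at p1 q1 a x, ratmap_at phi a a' &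
    ruled_at p2 q2 a' (A *m x + b)]).

(** Dominance of phi: its image meets the locus where h is nonzero, so the numerator of the
    composite of h with phi is a nonzero polynomial. *)
Lemma birational_pullback_neq0 (h : {mpoly R[2]}) : h != 0 ->
  exists2 H : {mpoly R[2]}, H != 0 &
    forall a a', peval a H != 0 -> ratmap_at phi a a' -> peval a' h != 0.
Proof.
move=> h0; have [g [_ /generically_setT[k k0 kP]]] := phi_birational.
have [b0] := mpoly_neq0_peval (mulf_neq0 h0 k0).
rewrite rmorphM mulf_eq0 negb_or => /andP[hb /kP[a0 [_ _ phia0]]].
have /choice[ND hND] : forall j, exists ND : {mpoly R[2]} * {mpoly R[2]},
    [/\ phi j 0 = tofrac ND.1 / tofrac ND.2, peval a0 ND.2 != 0 &
      b0 j 0 = peval a0 ND.1 / peval a0 ND.2].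
  by move=> j; have [N [D e]] := phia0 j; exists (N, D).
have [H [M HE]] := clear_denominators (fst \o ND) (snd \o ND) h.
have phiE a a' : (forall j, peval a (ND j).2 != 0) -> ratmap_at phi a a' ->
    a' = \col_j (peval a (ND j).1 / peval a (ND j).2).
  move=> Da pa; apply: (ratmap_at_uniq pa) => j; have [e _ _] := hND j.
  by exists (ND j).1, (ND j).2; rewrite mxE.
have prodE a : (forall j, peval a (ND j).2 != 0) -> \prod_j peval a (ND j).2 != 0.
  by move=> Da; apply/prodf_neq0 => j _.
(* The product of denominators guarantees that the value of phi at [a] is the one given by the fixed
   fractions [ND]. *)
exists (H * \prod_j (ND j).2).
  have Da0 j : peval a0 (ND j).2 != 0 by case: (hND j).
  apply: (@peval_neq0 _ _ a0); rewrite rmorphM rmorph_prod mulf_neq0 ?prodE //=.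
  by rewrite HE // mulf_neq0 ?expf_neq0 ?prodE //= -(phiE a0 b0).
move=> a a'; rewrite rmorphM rmorph_prod /= mulf_eq0 negb_or => /andP[Ha /prodf_neq0 Da] pa.
have Da' j : peval a (ND j).2 != 0 by exact: Da.
rewrite (phiE a a') //; apply: contraNneq Ha => e.
by rewrite HE //= e mulr0.
Qed.

(** For fixed good t the claim is a polynomial identity in s, so generic s suffice. There f(x1(t,
    s)) is also x2(tau, l s + m), and generic injectivity of x2 identifies phi(t, s) with (tau, l s
    + m). *)
Lemma phi_affine_in_s (N D : 'I_2 -> {mpoly R[2]}) :
  (forall j, D j != 0) -> (forall j, phi j 0 = tofrac (N j) / tofrac (D j)) ->
  exists s0 (w : {poly R}), w != 0 /\ forall t, w.[t] != 0 ->
    (forall j, peval (pt2 t s0) (D j) != 0) /\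
    exists tau l m, A *m dir_at q1 t = l *: dir_at q2 tau /\
      forall s j, peval (pt2 t s) (N j) = pt2 tau (l * s + m) j 0 * peval (pt2 t s) (D j).
Proof.
move=> D0 phiE.
have [h h0 hinj] := proper_generic_injective proper2.
have [H' H'0 hH'] := birational_pullback_neq0 h0.
have /generically_setT[hc hc0 hcP] := phi_comm.
have [w w0 hw] := rulings_correspond h0.
pose H := H' * hc * \prod_j D j.
have H0 : H != 0 by rewrite !mulf_neq0 //; apply/prodf_neq0 => j _.
have HP a : peval a H != 0 -> [/\ peval a H' != 0, peval a hc != 0 &
    forall j, peval a (D j) != 0].
  rewrite !rmorphM rmorph_prod /= !mulf_eq0 !negb_or => /andP[/andP[-> ->] /prodf_neq0 Da].
  by split=> // j; exact: Da.
have [a0 Ha0] := mpoly_neq0_peval H0.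
(* One height s0 serves all good t: [H] is nonzero at [a0], so its restriction to the row through
   [a0] is a nonzero polynomial in t. *)
exists (a0 1 0), (w * curve_sub (row_at (a0 1 0)) H); split.
  rewrite mulf_neq0 //; apply: (@horner_neq0 _ (a0 0 0)).
  by rewrite horner_row_at -pt2_eta.
move=> t; rewrite hornerM horner_row_at mulf_eq0 negb_or => /andP[/hw wt Ht].
split; first by case: (HP _ Ht).
have [u [u2 [tau [l [m [pu pu2 l0 [el em [s1 hs1]]]]]]]] := wt.
exists tau, l, m; split=> // s j.
pose vert P := curve_sub (affine_at t 1 0) P.
have vertE P x : (vert P).[x] = peval (pt2 t x) P.
  by rewrite horner_affine_at mul1r addr0.
(* Off the roots of [K], both H(t, s) and h(tau, l s + m) are nonzero. The second factor is tested
   at the s for which l s + m = s1. *)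
pose K := vert H * curve_sub (affine_at tau l m) h.
have K0 : K != 0.
  rewrite mulf_neq0 //.
    by apply: (@horner_neq0 _ (a0 1 0)); rewrite vertE.
  apply: (@horner_neq0 _ ((s1 - m) / l)).
  by rewrite horner_affine_at mulrC divfK // subrK.
pose val : {poly R} := if j == 0 then tau%:P else l *: 'X + m%:P.
have valE x : val.[x] = pt2 tau (l * x + m) j 0.
  by rewrite mxE /val; case: ifP; rewrite !hornerE.
rewrite -valE -!vertE -hornerM; congr (_.[s]); apply: (poly_eq_generic K0) => x.
rewrite hornerM (vertE H) (horner_affine_at h) mulf_eq0 negb_or => /andP[/HP[H'a hca Da] hx].
have [y [a' [xy pa' y2]]] := hcP _ hca.
(* Both parameters avoid the zeros of h, and x2 sends both to A x1(t, x) + b. *)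
have a'E : a' = pt2 tau (l * x + m).
 apply: (hinj _ _ _ _ hx y2); first exact: hH' pa'.
  exists u2; rewrite ?pt2_0 ?pt2_1 //.
  have -> : y = u + x *: dir_at q1 t.
    by apply: ruled_at_uniq xy _; exists u; rewrite ?pt2_0 ?pt2_1.
  by rewrite mulmxDr -scalemxAr el addrAC em scalerDl scalerA -addrA [x * l]mulrC
    [l * x *: _ + _]addrC.
rewrite hornerM valE !vertE -a'E; have [N' [D' [e D'a ->]]] := pa' j.
have : N j * D' = N' * D j.
  by apply/tofrac_div_eq; rewrite -?phiE ?D0 ?(peval_neq0 D'a).
move/(congr1 (peval (pt2 t x))); rewrite !rmorphM /= => ee.
by rewrite mulrAC -ee mulfK.
Qed.

End Correspondence.

(** * Reading off the Möbius transformation, k and c(t) *)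

Unset Implicit Arguments.

Theorem theorem8 (R : realType) (n : nat)
  (p1 p2 : 'cV[{fraction {poly R}}]_3) (q1 q2 : 'cV[{poly R}]_3)
  (proper1 : proper_param p1 q1) (proper2 : proper_param p2 q2)
  (ndr1 : ~ doubly_ruled (ruled_surface p1 q1))
  (ndr2 : ~ doubly_ruled (ruled_surface p2 q2))
  (ncyl1 : ~ cylindrical p1 q1) (ncyl2 : ~ cylindrical p2 q2)
  (coprime1 : coprime_dir q1) (coprime2 : coprime_dir q2)
  (deg1 : dir_degree q1 = n) (deg2 : dir_degree q2 = n)
  (A : 'M[R]_3) (b : 'cV[R]_3) (A_nonsingular : A \in unitmx)
  (fS : [set A *m x + b | x in ruled_surface p1 q1] = ruled_surface p2 q2)
  (phi : ratmap R 2 2)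
  (phi_birational :
    birational [set: 'cV[R]_2] [set: 'cV[R]_2] (ratmap_at phi))
  (phi_comm :
    generically [set: 'cV[R]_2] (fun a =>
      exists x a', [/\ ruled_at p1 q1 a x, ratmap_at phi a a' &
        ruled_at p2 q2 a' (A *m x + b)])) :
  exists (alpha beta gamma delta k : R) (c : {fraction {poly R}}),
    let psi := fun t : R => (alpha * t + beta) / (gamma * t + delta) in
    [/\ alpha * delta - beta * gamma != 0,
        generically [set: 'cV[R]_2] (fun a =>
          let t := a 0 0 in let s := a 1 0 in
          gamma * t + delta != 0 /\
          exists ct a', [/\ ratfun_at c t ct, ratmap_at phi a a',
            a' 0 0 = psi t &
            a' 1 0 = k * (gamma * t + delta) ^+ n * s + ct])
      & forall t : R, gamma * t + delta != 0 ->
          A *m dir_at q1 t =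
            (k * (gamma * t + delta) ^+ n) *: dir_at q2 (psi t)].
Proof.
have mov1 := noncylindrical_moving_dir coprime1 ncyl1.
have n0 : (0 < n)%N by rewrite -deg1 moving_dir_degree.
have /choice[ND hND] : forall j, exists ND : {mpoly R[2]} * {mpoly R[2]},
    ND.2 != 0 /\ phi j 0 = tofrac ND.1 / tofrac ND.2.
  by move=> j; have [N [D e]] := fracP (phi j 0); exists (N, D).
have [|j|s0 [w [w0 hw]]] := @phi_affine_in_s R p1 p2 q1 q2 A b proper1 proper2 ndr2 mov1
  coprime1 coprime2 A_nonsingular fS phi phi_birational phi_comm (fst \o ND) (snd \o ND).
- by move=> j; case: (hND j).
- by case: (hND j).
pose N j := curve_sub (row_at s0) (ND j).1.
pose D j := curve_sub (row_at s0) (ND j).2.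
have NE1 j t : (N j).[t] = peval (pt2 t s0) (ND j).1 := horner_row_at _ _ _.
have DE1 j t : (D j).[t] = peval (pt2 t s0) (ND j).2 := horner_row_at _ _ _.
have D0 : D 0 != 0.
  have [t /hw[/(_ 0) Dt _]] := poly_nonroot w0.
  by apply: (@horner_neq0 _ _ t); rewrite DE1.
(* The fraction giving tau is put in lowest terms, as the degree count requires a coprime pair. *)
have [Nr [Dr [g [NE DE copr]]]] : exists Nr Dr g,
    [/\ N 0 = Nr * g, D 0 = Dr * g & coprimep Nr Dr].
  exists (N 0 %/ gcdp (N 0) (D 0)), (D 0 %/ gcdp (N 0) (D 0)), (gcdp (N 0) (D 0)).
  by rewrite !divpK ?dvdp_gcdl ?dvdp_gcdr // coprimep_div_gcd // D0 orbT.
have tauE t tau l m : w.[t] != 0 ->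
    (forall s j, peval (pt2 t s) (ND j).1 =
       pt2 tau (l * s + m) j 0 * peval (pt2 t s) (ND j).2) ->
    Dr.[t] != 0 /\ tau = Nr.[t] / Dr.[t].
  move=> /hw[/(_ 0) /= D0t _] /(_ s0 0); rewrite pt2_0.
  move: D0t; rewrite -NE1 -DE1 NE DE !hornerM mulf_eq0 negb_or.
  move=> /andP[Dt gt] e; split=> //. apply: (mulIf gt); apply: (mulfI Dt).
  by rewrite [LHS]mulrCA -e; field.
have [||t wt|alpha [beta [gamma [delta [k [det Na Dg qE]]]]]] :=
  @proportional_mobius R n (affine_dir A q1) q2 Nr Dr w n0
    (coprime_affine_dir A_nonsingular coprime1) coprime2 _ deg2 w0.
- by rewrite dir_degree_affine.
- exact: copr.
- have [_ [tau [l [m [el hs]]]]] := hw t wt; have [Dt <-] := tauE _ _ _ _ wt hs.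
  by split=> //; exists l; rewrite dir_at_affine.
have NtE t : Nr.[t] = alpha * t + beta by rewrite Na !hornerE.
have DtE t : Dr.[t] = gamma * t + delta by rewrite Dg !hornerE.
have {}qE t : gamma * t + delta != 0 -> A *m dir_at q1 t =
    (k * (gamma * t + delta) ^+ n) *: dir_at q2 ((alpha * t + beta) / (gamma * t + delta)).
  by rewrite -DtE -NtE -dir_at_affine; exact: qE.
(* At s = s0 the second component of phi is l s0 + m with l = k Dr(t)^n; solving for m gives c. *)
pose c := tofrac (N 1) / tofrac (D 1) + tofrac (- (k * s0) *: Dr ^+ n).
exists alpha, beta, gamma, delta, k, c; split=> //.
have [W W0 WE] := poly_lift w0.
(* [W] keeps t off the roots of [w]; the two denominators make phi defined at the point through
   [ND]. *)
apply/generically_setT; exists (W * ((ND 0).2 * (ND 1).2)).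
  by case: (hND 0) (hND 1) => [d0 _] [d1 _]; rewrite !mulf_neq0.
move=> a; rewrite !rmorphM /= WE !mulf_eq0 !negb_or => /and3P[wa D0a D1a].
have [Ds0 [tau [l [m [el hs]]]]] := hw _ wa; have [Dt tE] := tauE _ _ _ _ wa hs.
rewrite NtE DtE in tE; rewrite DtE in Dt; split=> //.
(* A q1(t) is written twice as a multiple of q2(tau), and q2(tau) has a nonzero coordinate to
   cancel. *)
have lE : l = k * (gamma * a 0 0 + delta) ^+ n.
  have [j qj] := dir_at_neq0 tau coprime2; apply: (mulIf qj).
  by have := qE _ Dt; rewrite el -tE => /colP/(_ j); rewrite !mxE.
have D1s : (D 1).[a 0 0] != 0 by rewrite DE1; exact: Ds0 1.
exists m, (pt2 tau (l * a 1 0 + m)); split; rewrite ?pt2_0 ?pt2_1 ?lE //.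
  have -> : m = (N 1).[a 0 0] / (D 1).[a 0 0] + (- (k * s0) *: Dr ^+ n).[a 0 0].
    have := hs s0 1; rewrite pt2_1 NE1 DE1 => ->; rewrite mulfK; last exact: Ds0 1.
    by rewrite hornerZ horner_exp DtE lE; ring.
  apply: (@frac_atD _ _ (horner_eval (a 0 0))); last exact: (@frac_at_tofrac _ _ (horner_eval _)).
  exists (N 1), (D 1); split=> //; exact: D1s.
move=> j; exists (ND j).1, (ND j).2.
have Dj : peval a (ND j).2 != 0.
  case: j => [[|[|[]]]] //= i.
    by rewrite (_ : Ordinal i = 0) //; apply: val_inj.
  by rewrite (_ : Ordinal i = 1) //; apply: val_inj.
split=> //; first by case: (hND j).
by have := hs (a 1 0) j; rewrite -pt2_eta /= => ->; rewrite lE mulfK.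
Qed.
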